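(* Consider $k$ steps of the JBD process of $\{A,L\}$ with inexact inner iterations, and let $\tilde g_i\in\mathcal{R}(Q)$ be the vectors with $\beta_i\tilde v_{i+1}=QQ^T\begin{pmatrix}u_i\\0_p\end{pmatrix}-\alpha_i\tilde v_i-\tilde g_i$, $i=1,\dots,k$. Define $\mu_{ji}:=u_j^Tu_i$ and $\nu_{ji}:=\tilde v_j^T\tilde v_i$, and let $\beta_0\mu_{0i}=0$. Then for $i\le k$ the $\mu_{ji}$ and $\nu_{ji}$ satisfy the coupled recursive relations $$\alpha_i\mu_{ji}=\beta_j\nu_{j+1,i}+\alpha_j\nu_{ji}-\beta_{i-1}\mu_{j,i-1}+\tilde v_i^T\tilde g_j,\qquad 1\le j\le i-1,$$ $$\beta_i\nu_{j,i+1}=\alpha_j\mu_{ji}+\beta_{j-1}\mu_{j-1,i}-\alpha_i\nu_{ji}-\tilde v_j^T\tilde g_i,\qquad 1\le j\le i.$$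
   Context: $\|\cdot\|$ is the 2-norm; $\mathcal{R}(\cdot)$ is the range; $0_p$ is the zero vector of $\mathbb{R}^p$. Let $A\in\mathbb{R}^{m\times n}$, $L\in\mathbb{R}^{p\times n}$, $C=\begin{pmatrix}A\\L\end{pmatrix}$ with $\mathrm{rank}(C)=n$, and let $C=QR$ be the compact QR factorization, $Q\in\mathbb{R}^{(m+p)\times n}$ with orthonormal columns, $R\in\mathbb{R}^{n\times n}$ upper triangular and nonsingular. JBD process with inexact inner iterations: choose a nonzero $s\in\mathbb{R}^n$, set $\tilde v_1=Cs/\|Cs\|$, $\beta_0=0$, and for $i=1,\dots,k$: (1) $\alpha_iu_i=\tilde v_i(1:m)-\beta_{i-1}u_{i-1}$, $\|u_i\|=1$; (2) with $\tilde u_i=(u_i^T,0_p^T)^T$, compute an approximate solution $\bar z_i$ of $\min_{\tilde z\in\mathbb{R}^n}\|C\tilde z-\tilde u_i\|$ whose residual $\bar r_i=\tilde u_i-C\bar z_i$ satisfies $\|C^T\bar r_i\|/(\|C\|\|\bar r_i\|)\le\tau$ (stopping tolerance $\tau>0$); (3) $\beta_i\tilde v_{i+1}=C\bar z_i-\alpha_i\tilde v_i$, $\|\tilde v_{i+1}\|=1$. Here $\alpha_i,\beta_i>0$ are normalizing constants (the process does not break down in the first $k$ steps); all computations other than (2) are exact. (The process also generates vectors $\hat u_i$ and scalars $\hat\alpha_i,\hat\beta_i$, not needed here.) The vector $\tilde g_i$ is $C\tilde z_i-C\bar z_i$, where $\tilde z_i$ is the exact least squares solution. *)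

(* Defs.v *)
From HB Require Import structures.
From mathcomp Require Import all_boot all_order all_algebra.
From mathcomp Require Import classical_sets reals.

Set Implicit Arguments.
Unset Strict Implicit.
Unset Printing Implicit Defensive.

Import Order.TTheory GRing.Theory Num.Theory.
Local Open Scope ring_scope.

Definition dotv (R : realType) (q : nat) (x y : 'cV[R]_q) : R :=
  (x^T *m y) 0 0.

(* MathComp-Analysis norms matrices by the maximum of the absolute values of
   the entries, hence the explicit 2-norms below. *)
Definition norm2 (R : realType) (q : nat) (x : 'cV[R]_q) : R :=
  Num.sqrt (dotv x x).

Definition mxnorm2 (R : realType) (q r : nat) (M : 'M[R]_(q, r)) : R :=
  sup [set norm2 (M *m x) | x in [set x : 'cV[R]_r | norm2 x <= 1]]%classic.

(* MathComp's row-space relation <= describes the range of the transpose. *)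
Definition in_range (R : realType) (q r : nat) (M : 'M[R]_(q, r))
    (x : 'cV[R]_q) : Prop :=
  exists y : 'cV[R]_r, x = M *m y.

(* MathComp's is_trig_mx means lower triangular. *)
Definition compact_QR (R : realType) (q n : nat) (C : 'M[R]_(q, n))
    (Q : 'M[R]_(q, n)) (T : 'M[R]_n) : Prop :=
  [/\ C = Q *m T, Q^T *m Q = 1%:M, is_trig_mx T^T & T \in unitmx].

Definition pad0 (R : realType) (m p : nat) (x : 'cV[R]_m) : 'cV[R]_(m + p) :=
  col_mx x 0.
Arguments pad0 {R m} p x.

Definition least_squares_sol (R : realType) (q n : nat) (C : 'M[R]_(q, n))
    (b : 'cV[R]_q) (z : 'cV[R]_n) : Prop :=
  forall y : 'cV[R]_n, norm2 (b - C *m z) <= norm2 (b - C *m y).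

(* If the residual vanishes the quotient is 0 / 0, which is 0 in MathComp, so
   an exact solution of a consistent system is accepted. *)
Definition inexact_sol (R : realType) (q n : nat) (tau : R)
    (C : 'M[R]_(q, n)) (b : 'cV[R]_q) (z : 'cV[R]_n) : Prop :=
  let r := b - C *m z in
  norm2 (C^T *m r) / (mxnorm2 C * norm2 r) <= tau.

(* Sequences are indexed from 1 as usual for this process: u_1, ..., u_k,
   v_1, ..., v_{k+1} and z_1, ..., z_k are constrained.  The value u 0 is
   unconstrained and only ever occurs multiplied by beta 0 = 0. *)
Record inexact_JBD (R : realType) (m p n : nat)
    (A : 'M[R]_(m, n)) (L : 'M[R]_(p, n)) (tau : R) (k : nat)
    (s : 'cV[R]_n) (alpha beta : nat -> R) (u : nat -> 'cV[R]_m)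
    (v : nat -> 'cV[R]_(m + p)) (z : nat -> 'cV[R]_n) : Prop := InexactJBD {
  jbd_start_neq0 : s != 0;
  jbd_start : v 1%N = (norm2 (col_mx A L *m s))^-1 *: (col_mx A L *m s);
  jbd_beta0 : beta 0%N = 0;
  jbd_alpha_gt0 : forall i, (1 <= i <= k)%N -> 0 < alpha i;
  jbd_beta_gt0 : forall i, (1 <= i <= k)%N -> 0 < beta i;
  jbd_u : forall i, (1 <= i <= k)%N ->
    alpha i *: u i = usubmx (v i) - beta i.-1 *: u i.-1;
  jbd_u_unit : forall i, (1 <= i <= k)%N -> norm2 (u i) = 1;
  jbd_inner : forall i, (1 <= i <= k)%N ->
    inexact_sol tau (col_mx A L) (pad0 p (u i)) (z i);
  jbd_v : forall i, (1 <= i <= k)%N ->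
    beta i *: v i.+1 = col_mx A L *m z i - alpha i *: v i;
  jbd_v_unit : forall i, (1 <= i <= k)%N -> norm2 (v i.+1) = 1
}.

Definition inner_error (R : realType) (m p n : nat) (Q : 'M[R]_(m + p, n))
    (k : nat) (alpha beta : nat -> R) (u : nat -> 'cV[R]_m)
    (v g : nat -> 'cV[R]_(m + p)) : Prop :=
  forall i, (1 <= i <= k)%N ->
    in_range Q (g i) /\
    beta i *: v i.+1 = Q *m Q^T *m pad0 p (u i) - alpha i *: v i - g i.

Lemma dotv_ge0 (R : realType) (q : nat) (x : 'cV[R]_q) : 0 <= dotv x x.
Proof.
rewrite /dotv mxE; apply: sumr_ge0 => i _.
by rewrite mxE -expr2 sqr_ge0.
Qed.

Lemma dotv_eq0 (R : realType) (q : nat) (x : 'cV[R]_q) :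
  dotv x x = 0 -> x = 0.
Proof.
rewrite /dotv mxE => /eqP; rewrite psumr_eq0; last first.
  by move=> i _; rewrite mxE -expr2 sqr_ge0.
move=> /allP h; apply/matrixP => i j; rewrite ord1 [RHS]mxE.
have := h i (mem_index_enum _); rewrite /= mxE -expr2 sqrf_eq0.
by move/eqP.
Qed.

Lemma least_squares_proj (R : realType) (q n : nat) (C Q : 'M[R]_(q, n))
    (T : 'M[R]_n) (b : 'cV[R]_q) (z : 'cV[R]_n) :
  compact_QR C Q T -> least_squares_sol C b z -> C *m z = Q *m Q^T *m b.
Proof.
case=> CE QQ _ Tu /(_ (invmx T *m (Q^T *m b))).
have -> : C *m (invmx T *m (Q^T *m b)) = Q *m Q^T *m b.
  by rewrite CE -!mulmxA (mulKVmx Tu).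
rewrite /norm2 ler_sqrt ?dotv_ge0 //.
set w := b - Q *m Q^T *m b; set d := Q *m Q^T *m b - C *m z.
have -> : b - C *m z = w + d by rewrite /w /d addrA subrK.
have Qw : Q^T *m w = 0.
  by rewrite /w mulmxBr !mulmxA QQ mul1mx subrr.
have [y dE] : exists y, d = Q *m y.
  by exists (Q^T *m b - T *m z); rewrite /d CE mulmxBr !mulmxA.
have dw : d^T *m w = 0 by rewrite dE trmx_mul -mulmxA Qw mulmx0.
have wd : w^T *m d = 0 by rewrite -[LHS]trmxK trmx_mul trmxK dw trmx0.
have -> : dotv (w + d) (w + d) = dotv w w + dotv d d.
  clearbody w d; have tD : (w + d)^T = w^T + d^T by rewrite linearD.
  by rewrite /dotv tD mulmxDl !mulmxDr dw wd add0r addr0 mxE.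
rewrite gerDl => dle; apply/esym/eqP; rewrite -subr_eq0; apply/eqP.
by apply: dotv_eq0; apply/eqP; rewrite eq_le dle dotv_ge0.
Qed.

(* The vectors determined by inner_error are exactly the differences between
   the exact and the computed inner solutions, mapped by C. *)
Lemma inner_errorE (R : realType) (m p n : nat)
    (A : 'M[R]_(m, n)) (L : 'M[R]_(p, n)) (Q : 'M[R]_(m + p, n)) (T : 'M[R]_n)
    (tau : R) (k : nat) (s : 'cV[R]_n) (alpha beta : nat -> R)
    (u : nat -> 'cV[R]_m) (v g : nat -> 'cV[R]_(m + p))
    (z zls : nat -> 'cV[R]_n) :
  compact_QR (col_mx A L) Q T ->
  inexact_JBD A L tau k s alpha beta u v z ->
  (forall i, (1 <= i <= k)%N ->
     least_squares_sol (col_mx A L) (pad0 p (u i)) (zls i)) ->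
  inner_error Q k alpha beta u v g <->
  (forall i, (1 <= i <= k)%N ->
     g i = col_mx A L *m zls i - col_mx A L *m z i).
Proof.
move=> qr jbd ls; have [CE _ _ _] := qr.
have E i : (1 <= i <= k)%N ->
    Q *m Q^T *m pad0 p (u i) = col_mx A L *m zls i.
  by move=> ik; rewrite (least_squares_proj qr (ls i ik)).
split=> [h i ik | h i ik].
  have [_] := h i ik; rewrite (jbd_v jbd ik) E // => e.
  have {}e : col_mx A L *m z i = col_mx A L *m zls i - g i.
    apply: (addIr (- (alpha i *: v i))); rewrite e.
    by rewrite -!addrA [- _ - g i]addrC.
  by rewrite e opprB addrC subrK.
rewrite (h i ik) (jbd_v jbd ik) E //; split.
  by exists (T *m (zls i - z i)); rewrite mulmxA -CE mulmxBr.
by rewrite [RHS]addrAC opprB [X in _ = X - _]addrC subrK.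
Qed.

(* Main.v *)
Require Import Defs.
From mathcomp Require Import all_boot all_order all_algebra.
From mathcomp Require Import classical_sets reals.

(** Write [P = Q Q^T], the orthogonal projector onto the range of [Q], which is
    also the range of [C].  Every [v_i] lies in that range: [v_1] is a multiple
    of [C s], and each step of the process subtracts a multiple of [v_i] from a
    vector [C z_i] and rescales.  Since [P] is symmetric and fixes [v_j], padding
    with zeros and then projecting is adjoint to taking the first [m] components:
    [<v_j, P (u_i; 0)> = <P v_j, (u_i; 0)> = <v_j(1:m), u_i>]
    ([dotv_proj_pad0]).

    The process gives both sides of this identity a second form.  By the step
    that produces [u_j], the right-hand side is
    [<alpha_j u_j + beta_(j-1) u_(j-1), u_i>]; by the definition of the errors
    [g_i], the left-hand side is
    [<v_j, beta_i v_(i+1) + alpha_i v_i + g_i>].  Their equality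
    ([jbd_coupling]) holds for all [i] and [j] up to [k], in either order, so it
    contains both recursions: solving it for [<v_j, v_(i+1)>] gives the one
    for [nu], and exchanging the indices and solving for [<u_j, u_i>] gives
    the one for [mu]. *)

Set Implicit Arguments.
Unset Strict Implicit.
Unset Printing Implicit Defensive.

Import Order.TTheory GRing.Theory Num.Theory.
Local Open Scope ring_scope.

Section InnerProduct.
Variables (R : realType) (q : nat).
Implicit Types x y w : 'cV[R]_q.

Lemma dotvC x y : dotv x y = dotv y x.
Proof. by rewrite /dotv !mxE; apply: eq_bigr => l _; rewrite !mxE mulrC. Qed.

Lemma dotvDr x y w : dotv x (y + w) = dotv x y + dotv x w.
Proof. by rewrite /dotv mulmxDr mxE. Qed.

Lemma dotvZr (a : R) x y : dotv x (a *: y) = a * dotv x y.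
Proof. by rewrite /dotv -scalemxAr mxE. Qed.

End InnerProduct.

Lemma dotv_pad0 (R : realType) (m p : nat) (x : 'cV[R]_(m + p)) (y : 'cV[R]_m) :
  dotv x (pad0 p y) = dotv (usubmx x) y.
Proof.
by rewrite /dotv /pad0 -{1}[x]vsubmxK tr_col_mx mul_row_col mulmx0 addr0.
Qed.

Lemma in_range_combine (R : realType) (q r : nat) (M : 'M[R]_(q, r))
    (a : R) (x y : 'cV[R]_q) :
  in_range M x -> in_range M y -> in_range M (x + a *: y).
Proof.
move=> [x' ->] [y' ->]; exists (x' + a *: y').
by rewrite mulmxDr -scalemxAr.
Qed.

Lemma in_range_scale (R : realType) (q r : nat) (M : 'M[R]_(q, r))
    (a : R) (x : 'cV[R]_q) :
  in_range M x -> in_range M (a *: x).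
Proof. by move=> [y ->]; exists (a *: y); rewrite scalemxAr. Qed.

(** On the range of [Q], the map [y |-> Q Q^T (y; 0)] is adjoint to the
    restriction to the first components, because [Q Q^T] is symmetric and acts
    there as the identity. *)
Lemma dotv_proj_pad0 (R : realType) (m p n : nat) (Q : 'M[R]_(m + p, n))
    (x : 'cV[R]_(m + p)) (y : 'cV[R]_m) :
  Q^T *m Q = 1%:M -> in_range Q x ->
  dotv x (Q *m Q^T *m pad0 p y) = dotv (usubmx x) y.
Proof.
move=> QQ [w xE]; rewrite -dotv_pad0 /dotv xE trmx_mul !mulmxA.
by rewrite -[w^T *m Q^T *m Q]mulmxA QQ mulmx1.
Qed.

Section InexactJBD.
Variables (R : realType) (m p n : nat).
Variables (A : 'M[R]_(m, n)) (L : 'M[R]_(p, n)).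
Variables (Q : 'M[R]_(m + p, n)) (T : 'M[R]_n).
Variables (tau : R) (k : nat) (s : 'cV[R]_n) (alpha beta : nat -> R).
Variables (u : nat -> 'cV[R]_m) (v : nat -> 'cV[R]_(m + p)).
Variables (z : nat -> 'cV[R]_n) (g : nat -> 'cV[R]_(m + p)).
Hypothesis qrC : compact_QR (col_mx A L) Q T.
Hypothesis jbd : inexact_JBD A L tau k s alpha beta u v z.
Hypothesis gE : inner_error Q k alpha beta u v g.

(** The inner iterations may be inexact, but their results enter only through
    [C], so the [v_i] never leave the range of [C = Q T]. *)
Lemma jbd_v_in_range i : (1 <= i <= k.+1)%N -> in_range Q (v i).
Proof.
have [CE _ _ _] := qrC.
have rangeC y : in_range Q (col_mx A L *m y).
  by exists (T *m y); rewrite CE mulmxA.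
elim: i => // -[_ _|i IHi ik].
  by rewrite (jbd_start jbd); apply: in_range_scale.
have {}ik : (1 <= i.+1 <= k)%N by [].
have b_neq0 : beta i.+1 != 0 by rewrite gt_eqF // (jbd_beta_gt0 jbd).
rewrite -[v i.+2](scalerK b_neq0) (jbd_v jbd ik) -scaleNr.
apply/in_range_scale/in_range_combine => //.
by case/andP: ik => _ ik; apply: IHi; exact: leqW.
Qed.

(** The two ways of computing [<v_j, Q Q^T (u_i; 0)>]: through the outer
    recursion for [u_j] on the left, through the perturbed recursion for
    [v_(i+1)] on the right. *)
Lemma jbd_coupling i j : (1 <= i <= k)%N -> (1 <= j <= k)%N ->
  alpha j * dotv (u j) (u i) + beta j.-1 * dotv (u j.-1) (u i) =
  beta i * dotv (v j) (v i.+1) + alpha i * dotv (v j) (v i) + dotv (v j) (g i).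
Proof.
move=> ik jk; have [_ QQ _ _] := qrC; have [_ vE] := gE ik.
have vj : in_range Q (v j).
  by case/andP: jk => j_gt0 jk; apply: jbd_v_in_range; rewrite j_gt0 leqW.
have usubE : usubmx (v j) = alpha j *: u j + beta j.-1 *: u j.-1.
  by rewrite (jbd_u jbd jk) subrK.
have projE : Q *m Q^T *m pad0 p (u i) = beta i *: v i.+1 + alpha i *: v i + g i.
  by rewrite vE addrAC !subrK.
have := dotv_proj_pad0 (u i) QQ vj.
rewrite projE usubE [RHS]dotvC !dotvDr !dotvZr => ->.
by rewrite ![dotv (u i) _]dotvC.
Qed.

End InexactJBD.

Theorem theorem3p2 (R : realType) (m p n : nat)
    (A : 'M[R]_(m, n)) (L : 'M[R]_(p, n))
    (Q : 'M[R]_(m + p, n)) (T : 'M[R]_n)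
    (tau : R) (k : nat) (s : 'cV[R]_n) (alpha beta : nat -> R)
    (u : nat -> 'cV[R]_m) (v : nat -> 'cV[R]_(m + p)) (z : nat -> 'cV[R]_n)
    (g : nat -> 'cV[R]_(m + p))
    (rankC : \rank (col_mx A L) = n)
    (qrC : compact_QR (col_mx A L) Q T)
    (tau_gt0 : 0 < tau)
    (jbd : inexact_JBD A L tau k s alpha beta u v z)
    (gE : inner_error Q k alpha beta u v g) :
  let mu := fun j i : nat => dotv (u j) (u i) in
  let nu := fun j i : nat => dotv (v j) (v i) in
  forall i : nat, (1 <= i <= k)%N ->
    (forall j : nat, (1 <= j <= i.-1)%N ->
       alpha i * mu j i =
         beta j * nu j.+1 i + alpha j * nu j i - beta i.-1 * mu j i.-1
         + dotv (v i) (g j))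
    /\
    (forall j : nat, (1 <= j <= i)%N ->
       beta i * nu j i.+1 =
         alpha j * mu j i + beta j.-1 * mu j.-1 i - alpha i * nu j i
         - dotv (v j) (g i)).
Proof.
move=> mu nu i ik; split=> j /andP[j_gt0 ji].
  have jk : (1 <= j <= k)%N.
    case/andP: ik => _ ik; rewrite j_gt0 (leq_trans ji) //.
    exact: leq_trans (leq_pred i) ik.
  have := jbd_coupling qrC jbd gE jk ik.
  rewrite [dotv (u i) _]dotvC [dotv (u i.-1) _]dotvC.
  rewrite [dotv (v i) (v j.+1)]dotvC [dotv (v i) (v j)]dotvC => coupling.
  by rewrite /mu /nu addrAC -coupling addrK.
have jk : (1 <= j <= k)%N.
  by case/andP: ik => _ ik; rewrite j_gt0 (leq_trans ji).
by rewrite /mu /nu (jbd_coupling qrC jbd gE ik jk) addrAC !addrK.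
Qed.
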